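(* Let $(q(t),p(t))$ be a solution of the ${\rm P}_{\rm III'}$ Hamiltonian system with parameters $\mathbf v=(0,0)$, let $h(t)$ be the value of its Hamiltonian along this solution, and let $T=\tfrac14 t$. Let $(Q_W,P_W)$, $(Q_S,P_S)$, $(Q_E,P_E)$, $(Q_N,P_N)$ be the associated solutions (given by the explicit formulas in the context) of the ${\rm P}_{\rm III'}$ systems in the variable $T$ with parameters $(-1,0)$, $(0,-1)$, $(1,0)$, $(0,1)$ respectively, and let $H_W(T),H_S(T),H_E(T),H_N(T)$ be the values of the corresponding Hamiltonians along them. Then the Hamiltonians satisfy $$TH_W(T)+TH_S(T)+TH_E(T)+TH_N(T)=t\,h(t)-\tfrac14,$$ the canonical momenta satisfy $$P_W+P_S+P_E+P_N=4p,$$ and the $\tau$-functions satisfy $$T^{1/4}\,\tau_W(T)\,\tau_S(T)\,\tau_E(T)\,\tau_N(T)=\tau(t),$$ where $h=\frac{d}{dt}\log\tau$ and $H_X=\frac{d}{dT}\log\tau_X$ for $X\in\{W,S,E,N\}$, the last identity being understood up to the nonzero multiplicative constant left free in the definition of the $\tau$-functions.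
   Context: For parameters $\mathbf v=(v_1,v_2)\in\mathbb C^2$, the ${\rm P}_{\rm III'}$ Hamiltonian system $\{q,p;t,H\}$ has the Hamiltonian $H=H(q,p;t;\mathbf v)$ given by $$tH=q^2p^2-(q^2+v_1q-t)p+\tfrac12(v_1+v_2)q,$$ and Hamilton equations $q'=\partial H/\partial p$, $p'=-\partial H/\partial q$ (with $'=d/dt$), i.e. $$tq'=2q^2p-q^2-v_1q+t,\qquad tp'=-2qp^2+(2q+v_1)p-\tfrac12(v_1+v_2).$$ The same formulas with $(q,p,t)$ replaced by $(Q,P,T)$ and $'=d/dT$ define the system $\{Q,P;T,H\}$. The $\tau$-function of a solution is defined, up to a nonzero multiplicative constant, by $H(t)=\frac{d}{dt}\log\tau(t)$, where $H(t)$ is the Hamiltonian evaluated along the solution. Given a solution $(q,p)$ with $\mathbf v=(0,0)$, the associated solutions in the variable $T=\frac14t$ are as follows. $\mathbf v=(-1,0)$: $$Q_W=\frac{i\sqrt t}{2}\left(\sqrt p+\sqrt{p-1}\right),\qquad P_W=\frac{i}{\sqrt t}\,\frac{\tfrac12+q\sqrt p\sqrt{p-1}-i\sqrt t\sqrt p}{\sqrt p+\sqrt{p-1}}.$$ $\mathbf v=(0,-1)$: $$Q_S=\frac{i\sqrt t}{2}\,\frac{1}{\sqrt p+\sqrt{p-1}}\;\frac{\tfrac12+q\sqrt p\sqrt{p-1}-i\sqrt t\sqrt{p-1}}{\tfrac12-q\sqrt p\sqrt{p-1}+i\sqrt t\sqrt{p-1}},$$ $$P_S=-\frac{i}{\sqrt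 t}\left(\sqrt p+\sqrt{p-1}\right)\left[\tfrac12-q\sqrt p\sqrt{p-1}+i\sqrt t\sqrt p\right].$$ $\mathbf v=(1,0)$: $$Q_E=-\frac{i\sqrt t}{2}\left(\sqrt p+\sqrt{p-1}\right)\left\{1-\frac{1}{\tfrac12+q\sqrt p\sqrt{p-1}-i\sqrt t\sqrt{p-1}}-\frac{1}{\tfrac12+q\sqrt p\sqrt{p-1}+i\sqrt t\sqrt p}\right\},$$ $$P_E=-\frac{i}{\sqrt t}\,\frac{\tfrac12+q\sqrt p\sqrt{p-1}+i\sqrt t\sqrt p}{\sqrt p+\sqrt{p-1}}.$$ $\mathbf v=(0,1)$: $$Q_N=-\frac{i\sqrt t}{2}\,\frac{1}{\sqrt p+\sqrt{p-1}}\;\frac{\tfrac12+q\sqrt p\sqrt{p-1}+i\sqrt t\sqrt p}{\tfrac12-q\sqrt p\sqrt{p-1}-i\sqrt t\sqrt p},$$ $$P_N=\frac{i}{\sqrt t}\,\frac{\tfrac12-q\sqrt p\sqrt{p-1}-i\sqrt t\sqrt p}{\sqrt p-\sqrt{p-1}}.$$ Here $(q(t),p(t))$ are complex analytic functions on a simply connected domain of $\mathbb C\setminus\{0\}$ on which analytic branches of $\sqrt t,\sqrt p,\sqrt{p-1}$ (and of $T^{1/4}$) are fixed; each of these symbols denotes the same branch throughout all the formulas. The formulas are understood generically: where $t,p,p-1$ and all displayed denominators are nonzero. *)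

(* Defs.v *)
From Stdlib Require Import Reals.
From Coquelicot Require Import Coquelicot.

Open Scope C_scope.

(* A path is a map R -> C of which only the restriction to [0,1] matters.
   Continuity is asked two-sidedly, also at the end points; this is no
   restriction, since a map continuous on [0,1] (or on the square [0,1]^2)
   extends continuously by clamping its arguments. *)
Definition path_in (D : C -> Prop) (gamma : R -> C) : Prop :=
  forall s : R, (0 <= s <= 1)%R -> continuous gamma s /\ D (gamma s).

Definition path_connected (D : C -> Prop) : Prop :=
  forall a b : C, D a -> D b ->
  exists gamma : R -> C, path_in D gamma /\ gamma 0%R = a /\ gamma 1%R = b.

(* Gamma (s, u) : s is the loop parameter, u the deformation parameter, and the
   base point gamma 0 stays fixed. *)
Definition null_homotopic_in (D : C -> Prop) (gamma : R -> C) : Prop :=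
  exists Gamma : R * R -> C,
    (forall s u : R, (0 <= s <= 1)%R -> (0 <= u <= 1)%R ->
       continuous Gamma (s, u) /\ D (Gamma (s, u))) /\
    (forall s : R, (0 <= s <= 1)%R ->
       Gamma (s, 0%R) = gamma s /\ Gamma (s, 1%R) = gamma 0%R) /\
    (forall u : R, (0 <= u <= 1)%R ->
       Gamma (0%R, u) = gamma 0%R /\ Gamma (1%R, u) = gamma 0%R).

Definition simply_connected_domain (D : C -> Prop) : Prop :=
  open D /\ (exists z : C, D z) /\ path_connected D /\
  (forall gamma : R -> C,
     path_in D gamma -> gamma 0%R = gamma 1%R -> null_homotopic_in D gamma).

(* Derivatives of functions C -> C are complex derivatives: the scalar field of
   [is_derive], [ex_derive] is C here, and on an open set complex
   differentiability is analyticity. *)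
Definition analytic_on (D : C -> Prop) (f : C -> C) : Prop :=
  forall z : C, D z -> ex_derive f z.

Definition root_branch (n : nat) (D : C -> Prop) (f g : C -> C) : Prop :=
  analytic_on D g /\ forall z : C, D z -> g z ^ n = f z.

Definition hamiltonian (v1 v2 q p t : C) : C :=
  (q ^ 2 * p ^ 2 - (q ^ 2 + v1 * q - t) * p + (v1 + v2) / 2 * q) / t.

Definition hamiltonian_along (v1 v2 : C) (q p : C -> C) (t : C) : C :=
  hamiltonian v1 v2 (q t) (p t) t.

Definition PIII'_solution (v1 v2 : C) (D : C -> Prop) (q p : C -> C) : Prop :=
  forall t : C, D t ->
    is_derive q t (C_derive (fun y : C => hamiltonian v1 v2 (q t) y t) (p t)) /\
    is_derive p t (- C_derive (fun x : C => hamiltonian v1 v2 x (p t) t) (q t)).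

(* H = (log tau)' on U, written without choosing a branch of the logarithm. *)
Definition tau_function (U : C -> Prop) (H tau : C -> C) : Prop :=
  forall t : C, U t ->
    tau t <> 0 /\ ex_derive tau t /\ H t = C_derive tau t / tau t.

(* In what follows st, sp, sp1 stand for the chosen branches of sqrt t, sqrt p,
   sqrt (p - 1), as functions of t; the transformed solutions are functions of
   T = t / 4, hence the evaluations at t = 4 T. *)

Definition QW (q st sp sp1 : C -> C) (T : C) : C :=
  let t := 4 * T in
  Ci * st t / 2 * (sp t + sp1 t).

Definition PW (q st sp sp1 : C -> C) (T : C) : C :=
  let t := 4 * T in
  Ci / st t *
  ((1 / 2 + q t * sp t * sp1 t - Ci * st t * sp t) / (sp t + sp1 t)).

Definition QS (q st sp sp1 : C -> C) (T : C) : C :=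
  let t := 4 * T in
  Ci * st t / 2 * (1 / (sp t + sp1 t)) *
  ((1 / 2 + q t * sp t * sp1 t - Ci * st t * sp1 t) /
   (1 / 2 - q t * sp t * sp1 t + Ci * st t * sp1 t)).

Definition PS (q st sp sp1 : C -> C) (T : C) : C :=
  let t := 4 * T in
  - (Ci / st t) * (sp t + sp1 t) *
  (1 / 2 - q t * sp t * sp1 t + Ci * st t * sp t).

Definition QE (q st sp sp1 : C -> C) (T : C) : C :=
  let t := 4 * T in
  - (Ci * st t / 2) * (sp t + sp1 t) *
  (1 - 1 / (1 / 2 + q t * sp t * sp1 t - Ci * st t * sp1 t)
     - 1 / (1 / 2 + q t * sp t * sp1 t + Ci * st t * sp t)).

Definition PE (q st sp sp1 : C -> C) (T : C) : C :=
  let t := 4 * T in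
  - (Ci / st t) *
  ((1 / 2 + q t * sp t * sp1 t + Ci * st t * sp t) / (sp t + sp1 t)).

Definition QN (q st sp sp1 : C -> C) (T : C) : C :=
  let t := 4 * T in
  - (Ci * st t / 2) * (1 / (sp t + sp1 t)) *
  ((1 / 2 + q t * sp t * sp1 t + Ci * st t * sp t) /
   (1 / 2 - q t * sp t * sp1 t - Ci * st t * sp t)).

Definition PN (q st sp sp1 : C -> C) (T : C) : C :=
  let t := 4 * T in
  Ci / st t *
  ((1 / 2 - q t * sp t * sp1 t - Ci * st t * sp t) / (sp t - sp1 t)).

(* The points of D at which t, p, p - 1 and every denominator occurring in the
   eight formulas above are nonzero. *)
Definition generic (D : C -> Prop) (q p st sp sp1 : C -> C) (t : C) : Prop :=
  D t /\ t <> 0 /\ p t <> 0 /\ p t - 1 <> 0 /\ st t <> 0 /\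
  sp t + sp1 t <> 0 /\ sp t - sp1 t <> 0 /\
  1 / 2 - q t * sp t * sp1 t + Ci * st t * sp1 t <> 0 /\
  1 / 2 + q t * sp t * sp1 t - Ci * st t * sp1 t <> 0 /\
  1 / 2 + q t * sp t * sp1 t + Ci * st t * sp t <> 0 /\
  1 / 2 - q t * sp t * sp1 t - Ci * st t * sp t <> 0.

Definition HW (q st sp sp1 : C -> C) : C -> C :=
  hamiltonian_along (-1) 0 (QW q st sp sp1) (PW q st sp sp1).
Definition HS (q st sp sp1 : C -> C) : C -> C :=
  hamiltonian_along 0 (-1) (QS q st sp sp1) (PS q st sp sp1).
Definition HE (q st sp sp1 : C -> C) : C -> C :=
  hamiltonian_along 1 0 (QE q st sp sp1) (PE q st sp sp1).
Definition HN (q st sp sp1 : C -> C) : C -> C :=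
  hamiltonian_along 0 1 (QN q st sp sp1) (PN q st sp sp1).

(* Main.v *)
Require Import Defs.
From Stdlib Require Import Reals Lra Classical ClassicalEpsilon.
From Coquelicot Require Import Coquelicot.

(* With [t = - w^2], [w = i sqrt t], and [sqrt p = (u + 1/u)/2],
   [sqrt (p - 1) = (u - 1/u)/2], the sums of Hamiltonians and of momenta become
   rational identities in [q, u, w].  The first one says that the quotient of
   [T^(1/4) tau_W tau_S tau_E tau_N] by [tau] has zero derivative at the generic
   points; it remains to see that these points, if there are any, fill the domain
   up to isolated points.  Both [p] and [p - 1] solve linear homogeneous
   equations, [t p' = - 2 q (p - 1) p], so they vanish nowhere or everywhere.
   Each denominator [d] satisfies
   [d' = i / sqrt t (e + c d)] with [e] equal up to sign to
   [(sqrt p + sqrt (p - 1)) / 2] or [(sqrt p - sqrt (p - 1)) / 2], which never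
   vanish, so its zeros are simple and hence isolated. *)

Open Scope C_scope.

(** * Complex derivatives *)

Lemma RtoC_neq_0 (x : R) : x <> 0%R -> RtoC x <> 0.
Proof. intros Hx H. apply Hx. now apply RtoC_inj. Qed.

Lemma continuous_C_Cmod (gamma : R -> C) (s eps : R) :
  continuous gamma s -> (0 < eps)%R ->
  locally s (fun u => (Cmod (gamma u - gamma s) < eps)%R).
Proof.
  intros Hc He.
  assert (Hs : (0 < sqrt 2)%R) by (apply sqrt_lt_R0; lra).
  (* The balls of [continuous] on C compare coordinates, and the modulus exceeds the larger
     coordinate by a factor of at most sqrt 2. *)
  assert (Hd : (0 < eps / sqrt 2)%R) by now apply Rdiv_lt_0_compat.
  pose proof (Hc _ (locally_ball (gamma s) (mkposreal _ Hd))) as H.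
  unfold filtermap in H. refine (filter_imp _ _ _ H). intros u Hu.
  apply (C_NormedModule_mixin_compat2 (gamma s) (gamma u) (mkposreal _ Hd)) in Hu.
  simpl in Hu. replace (sqrt 2 * (eps / sqrt 2))%R with eps in Hu by (field; lra).
  exact Hu.
Qed.

Lemma open_Cmod (D : C -> Prop) (z : C) :
  open D -> D z -> exists r : R, (0 < r)%R /\ forall w, (Cmod (w - z) < r)%R -> D w.
Proof.
  intros Ho Hz. destruct (Ho z Hz) as [r Hr].
  exists r; split; [apply cond_pos|]. intros w Hw. apply Hr.
  now apply C_NormedModule_mixin_compat1.
Qed.

(** Replaces the filter definition by estimates in the modulus, the form used by the local arguments
    below. *)
Lemma is_derive_C_iff (f : C -> C) (z l : C) :
  is_derive f z l <->
  forall eps : R, (0 < eps)%R -> exists r : R, (0 < r)%R /\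
    forall w, (Cmod (w - z) < r)%R ->
      (Cmod (f w - f z - l * (w - z)) <= eps * Cmod (w - z))%R.
Proof.
  split.
  - intros [_ H] eps He.
    destruct (H z (fun P HP => HP) (mkposreal _ He)) as [r Hr].
    exists r; split; [apply cond_pos|]. intros w Hw.
    replace (f w - f z - l * (w - z))
      with (minus (minus (f w) (f z)) (scal (minus w z) l))
      by (change (f w - f z - (w - z) * l = f w - f z - l * (w - z)); ring).
    exact (Hr w Hw).
  - intros H. split; [apply is_linear_scal_l|]. intros x Hx eps.
    rewrite <- (is_filter_lim_locally_unique (K := C_AbsRing)
                 (V := AbsRing_NormedModule C_AbsRing) z x Hx).
    destruct (H eps (cond_pos eps)) as [r [Hr Hw]].
    exists (mkposreal _ Hr). intros w Hb. specialize (Hw w Hb).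
    replace (f w - f z - l * (w - z))
      with (minus (minus (f w) (f z)) (scal (minus w z) l)) in Hw
      by (change (f w - f z - (w - z) * l = f w - f z - l * (w - z)); ring).
    exact Hw.
Qed.

Lemma is_derive_eq (f : C -> C) (z l l' : C) :
  is_derive f z l -> l = l' -> is_derive f z l'.
Proof. intros H <-. exact H. Qed.

Lemma is_derive_local (f g : C -> C) (z l : C) (d : R) :
  (0 < d)%R -> (forall w, (Cmod (w - z) < d)%R -> f w = g w) ->
  is_derive f z l -> is_derive g z l.
Proof.
  intros Hd Hfg. apply is_derive_ext_loc.
  exists (mkposreal _ Hd). intros w Hw. apply Hfg. exact Hw.
Qed.

Lemma is_derive_C_const (c z : C) : is_derive (fun _ : C => c) z (0 : C).
Proof. exact (is_derive_const c z). Qed.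

(* C carries two normed module structures over itself, with different balls; the
   product and chain rules of the library use [AbsRing_NormedModule]. *)
Lemma is_derive_AbsRing (f : C -> C) (z l : C) :
  is_derive (V := AbsRing_NormedModule C_AbsRing) f z l <->
  is_derive (V := C_NormedModule) f z l.
Proof. split; intros [_ H]; (split; [apply is_linear_scal_l|exact H]). Qed.

Lemma is_derive_C_id (z : C) : is_derive (fun w : C => w) z (1 : C).
Proof. apply is_derive_AbsRing. exact (is_derive_id (K := C_AbsRing) z). Qed.

Lemma is_derive_C_plus (f g : C -> C) (z df dg : C) :
  is_derive f z df -> is_derive g z dg ->
  is_derive (fun w => f w + g w) z (df + dg).
Proof. exact (is_derive_plus f g z df dg). Qed.

Lemma is_derive_C_opp (f : C -> C) (z df : C) :
  is_derive f z df -> is_derive (fun w => - f w) z (- df).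
Proof. exact (is_derive_opp f z df). Qed.

Lemma is_derive_C_minus (f g : C -> C) (z df dg : C) :
  is_derive f z df -> is_derive g z dg ->
  is_derive (fun w => f w - g w) z (df - dg).
Proof. exact (is_derive_minus f g z df dg). Qed.

Lemma is_derive_C_mult (f g : C -> C) (z df dg : C) :
  is_derive f z df -> is_derive g z dg ->
  is_derive (fun w => f w * g w) z (df * g z + f z * dg).
Proof.
  intros Hf%is_derive_AbsRing Hg%is_derive_AbsRing. apply is_derive_AbsRing.
  exact (is_derive_mult (K := C_AbsRing) f g z df dg Hf Hg Cmult_comm).
Qed.

Lemma is_derive_C_pow (f : C -> C) (n : nat) (z l : C) :
  is_derive f z l ->
  is_derive (fun w => f w ^ n) z (RtoC (INR n) * f z ^ pred n * l).
Proof.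
  intros Hf. induction n as [|n IH].
  - apply is_derive_eq with (1 := is_derive_C_const 1 z). simpl. ring.
  - apply is_derive_eq with (1 := is_derive_C_mult _ _ _ _ _ Hf IH).
    (* For [n = 0] the truncated exponent [pred 0 = 0] is harmless, because the coefficient [INR 0]
       vanishes. *)
    rewrite S_INR, RtoC_plus. destruct n; simpl; ring.
Qed.

Lemma is_derive_C_inv_id (z : C) : z <> 0 -> is_derive Cinv z (- / (z * z)).
Proof.
  intros Hz. assert (Hm := proj1 (Cmod_gt_0 z) Hz). apply is_derive_C_iff. intros eps He.
  set (m := Cmod z) in *.
  (* The remainder is (w - z)^2 / (w z^2). The first bound gives |w| > m/2; the second then makes
     the remainder at most eps |w - z|. *)
  exists (Rmin (m / 2) (eps * m ^ 3 / 2)). split.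
  { apply Rmin_glb_lt; [lra|]. apply Rdiv_lt_0_compat; [|lra].
    apply Rmult_lt_0_compat; [lra|now apply pow_lt]. }
  intros w Hw.
  assert (H1 : (Cmod (w - z) < m / 2)%R) by (eapply Rlt_le_trans; [exact Hw|apply Rmin_l]).
  assert (H2 : (Cmod (w - z) < eps * m ^ 3 / 2)%R)
    by (eapply Rlt_le_trans; [exact Hw|apply Rmin_r]).
  assert (H3 : (m / 2 < Cmod w)%R).
  { assert (m <= Cmod (w - z) + Cmod w)%R; [|lra].
    unfold m. replace z with (- (w - z) + w) at 1 by ring.
    eapply Rle_trans; [apply Cmod_triangle|]. rewrite Cmod_opp. lra. }
  assert (Hw0 : w <> 0) by (apply Cmod_gt_0; lra).
  replace (/ w - / z - - / (z * z) * (w - z)) with ((w - z) * (w - z) / (w * z * z))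
    by (field; auto).
  rewrite Cmod_div by (repeat apply Cmult_neq_0; auto).
  rewrite !Cmod_mult. fold m. set (d := Cmod (w - z)) in *.
  assert (0 <= d)%R by apply Cmod_ge_0.
  apply Rmult_le_reg_r with (Cmod w * m * m)%R.
  { repeat apply Rmult_lt_0_compat; lra. }
  unfold Rdiv at 1. rewrite Rmult_assoc, Rinv_l, Rmult_1_r;
    [|assert (0 < Cmod w * m * m)%R by (repeat apply Rmult_lt_0_compat; lra); lra].
  replace (eps * d * (Cmod w * m * m))%R with (d * (eps * (m * m) * Cmod w))%R by ring.
  apply Rmult_le_compat_l; [assumption|].
  apply Rle_trans with (eps * (m * m) * (m / 2))%R; [simpl in H2; lra|].
  apply Rmult_le_compat_l; [|lra].
  apply Rmult_le_pos; [lra|]. apply Rmult_le_pos; lra.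
Qed.

Lemma is_derive_C_comp (f g : C -> C) (z l m : C) :
  is_derive f (g z) l -> is_derive g z m -> is_derive (fun w => f (g w)) z (l * m).
Proof.
  intros Hf Hg%is_derive_AbsRing. apply is_derive_eq with (m * l); [|ring].
  exact (is_derive_comp (K := C_AbsRing) f g z l m Hf Hg).
Qed.

Lemma is_derive_C_div (f g : C -> C) (z df dg : C) :
  g z <> 0 -> is_derive f z df -> is_derive g z dg ->
  is_derive (fun w => f w / g w) z ((df * g z - f z * dg) / (g z * g z)).
Proof.
  intros H0 Hf Hg.
  apply is_derive_eq with (df * / g z + f z * (- / (g z * g z) * dg)); [|field; auto].
  apply (is_derive_C_mult f (fun w => / g w)); [assumption|].
  apply (is_derive_C_comp Cinv g); [now apply is_derive_C_inv_id|assumption].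
Qed.

(** * Propagation along paths *)

(** Chain rule from complex to real derivatives; [phi] is a real-linear functional bounded by the
    modulus, later [Re] or [Im]. *)
Lemma is_derive_along_segment (phi : C -> R) (f : C -> C) (a b l : C) (s : R) :
  (forall x y, phi (x - y) = (phi x - phi y)%R) ->
  (forall (k : R) x, phi (k * x) = (k * phi x)%R) ->
  (forall x, (Rabs (phi x) <= Cmod x)%R) ->
  is_derive f (a + s * (b - a)) l ->
  is_derive (fun u : R => phi (f (a + u * (b - a)))) s (phi (l * (b - a))).
Proof.
  intros Hm Hs Hb Hf. split; [apply is_linear_scal_l|]. intros x Hx eps.
  rewrite <- (is_filter_lim_locally_unique _ _ Hx). clear x Hx.
  (* The summand 1 keeps [M] positive when [a = b]. *)
  set (M := (Cmod (b - a) + 1)%R).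
  assert (HM : (0 < M)%R) by (pose proof (Cmod_ge_0 (b - a)); unfold M; lra).
  destruct (proj1 (is_derive_C_iff _ _ _) Hf (eps / M)%R) as [r [Hr H]].
  { apply Rdiv_lt_0_compat; [apply cond_pos|exact HM]. }
  assert (Hd : (0 < r / M)%R) by now apply Rdiv_lt_0_compat.
  exists (mkposreal _ Hd). intros u Hu. change (Rabs (u - s) < r / M)%R in Hu.
  assert (E : a + u * (b - a) - (a + s * (b - a)) = (u - s)%R * (b - a))
    by (rewrite RtoC_minus; ring).
  assert (L : (Cmod (a + u * (b - a) - (a + s * (b - a))) <= Rabs (u - s) * M)%R).
  { rewrite E, Cmod_mult, Cmod_R. apply Rmult_le_compat_l; [apply Rabs_pos|].
    unfold M; lra. }
  assert (Hl : (Rabs (u - s) * M < r)%R).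
  { apply Rmult_lt_compat_r with (r := M) in Hu; [|exact HM].
    replace (r / M * M)%R with r in Hu by (field; lra). exact Hu. }
  specialize (H (a + u * (b - a)) (Rle_lt_trans _ _ _ L Hl)).
  change (Rabs ((phi (f (a + u * (b - a))%C) - phi (f (a + s * (b - a))%C))
    - (u - s) * phi (l * (b - a))%C) <= eps * Rabs (u - s))%R.
  rewrite <- Hs, <- !Hm.
  eapply Rle_trans; [apply Hb|].
  replace (f (a + u * (b - a)) - f (a + s * (b - a)) - (u - s)%R * (l * (b - a)))
    with (f (a + u * (b - a)) - f (a + s * (b - a))
          - l * (a + u * (b - a) - (a + s * (b - a))))
    by (rewrite E; ring).
  eapply Rle_trans; [exact H|].
  replace (eps * Rabs (u - s))%R with (eps / M * (Rabs (u - s) * M))%R by (field; lra).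
  apply Rmult_le_compat_l; [|exact L].
  apply Rlt_le, Rdiv_lt_0_compat; [apply cond_pos|exact HM].
Qed.

Lemma is_derive_Re_along_segment (f : C -> C) (a b l : C) (s : R) :
  is_derive f (a + s * (b - a)) l ->
  is_derive (fun u : R => Re (f (a + u * (b - a)))) s (Re (l * (b - a))).
Proof.
  apply is_derive_along_segment; [reflexivity| |apply re_le_Cmod].
  exact re_scal_l.
Qed.

Lemma im_le_Cmod (z : C) : (Rabs (Im z) <= Cmod z)%R.
Proof.
  eapply Rle_trans; [apply Rmax_r|]. apply (Rmax_Cmod z).
Qed.

Lemma is_derive_Im_along_segment (f : C -> C) (a b l : C) (s : R) :
  is_derive f (a + s * (b - a)) l ->
  is_derive (fun u : R => Im (f (a + u * (b - a)))) s (Im (l * (b - a))).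
Proof.
  apply is_derive_along_segment; [reflexivity| |apply im_le_Cmod].
  intros k x. rewrite im_mult. simpl. ring.
Qed.

Lemma is_derive_0_segment (f : C -> C) (a b : C) :
  (forall s : R, (0 <= s <= 1)%R -> is_derive f (a + s * (b - a)) (RtoC 0)) ->
  f a = f b.
Proof.
  intros H.
  assert (E0 : a + 0%R * (b - a) = a) by ring.
  assert (E1 : a + 1%R * (b - a) = b) by ring.
  rewrite <- E0 at 1. rewrite <- E1 at 2.
  apply injective_projections.
  - apply (eq_is_derive (fun u : R => Re (f (a + u * (b - a)))) 0 1); [|lra].
    intros s Hs. replace (zero : R_NormedModule) with (Re (0 * (b - a))).
    + now apply is_derive_Re_along_segment, H.
    + rewrite Cmult_0_l. reflexivity.
  - apply (eq_is_derive (fun u : R => Im (f (a + u * (b - a)))) 0 1); [|lra].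
    intros s Hs. replace (zero : R_NormedModule) with (Im (0 * (b - a))).
    + now apply is_derive_Im_along_segment, H.
    + rewrite Cmult_0_l. reflexivity.
Qed.

(** * Convexity of discs and Gronwall's estimate *)

Lemma Cmod_segment (v : C) (s : R) : (0 <= s <= 1)%R -> (Cmod (s * v) <= Cmod v)%R.
Proof.
  intros Hs. rewrite Cmod_mult, Cmod_R, Rabs_pos_eq by lra.
  pose proof (Cmod_ge_0 v). nra.
Qed.

Lemma Cmod_convex (v w : C) (r s : R) :
  (Cmod v < r)%R -> (Cmod w < r)%R -> (0 <= s <= 1)%R ->
  (Cmod (v + s * (w - v)) < r)%R.
Proof.
  intros Hv Hw Hs.
  replace (v + s * (w - v)) with ((1 - s)%R * v + s * w)
    by (rewrite RtoC_minus; ring).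
  eapply Rle_lt_trans; [apply Cmod_triangle|].
  (* One of the weights [s], [1 - s] is at least 1/2, which yields the strict inequality. *)
  rewrite !Cmod_mult, !Cmod_R, !Rabs_pos_eq by lra. destruct (Rle_lt_dec s (1 / 2)); nra.
Qed.


(** Cauchy-Schwarz: the left side is the real part of conj(u) v. *)
Lemma Re_Im_inner_le (u v : C) : (Re u * Re v + Im u * Im v <= Cmod u * Cmod v)%R.
Proof.
  rewrite <- (Cmod_conj u), <- Cmod_mult.
  eapply Rle_trans; [|apply re_le_Cmod]. eapply Rle_trans; [|apply Rle_abs].
  rewrite re_mult. unfold Re, Im, Cconj. simpl. lra.
Qed.

(* Gronwall: [|f|^2 exp (- 2 K |w - z| s)] is nonincreasing along the segment
   from [z] to [w]. *)
Lemma linear_ode_zero_near (f k : C -> C) (z : C) (r K : R) :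
  (forall w, (Cmod (w - z) < r)%R -> is_derive f w (k w * f w)) ->
  (forall w, (Cmod (w - z) < r)%R -> (Cmod (k w) <= K)%R) ->
  f z = 0 -> forall w, (Cmod (w - z) < r)%R -> f w = 0.
Proof.
  intros Hf Hk Hz w Hw.
  set (L := (2 * (K * Cmod (w - z)))%R).
  set (y := fun s : R => f (z + s * (w - z))).
  set (yr := fun s : R => Re (y s)). set (yi := fun s : R => Im (y s)).
  set (dy := fun s : R => k (z + s * (w - z)) * y s * (w - z)).
  set (h := fun s : R => ((yr s * yr s + yi s * yi s) * exp (- L * s))%R).
  set (dh := fun s : R =>
    ((2 * (yr s * Re (dy s) + yi s * Im (dy s))
      - L * (yr s * yr s + yi s * yi s)) * exp (- L * s))%R).
  assert (Hin : forall s : R, (0 <= s <= 1)%R -> (Cmod (z + s * (w - z) - z) < r)%R).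
  { intros s Hs. replace (z + s * (w - z) - z) with (s * (w - z)) by ring.
    eapply Rle_lt_trans; [now apply Cmod_segment|exact Hw]. }
  assert (Hd : forall s : R, (0 <= s <= 1)%R -> is_derive h s (dh s)).
  { intros s Hs.
    assert (HR : is_derive yr s (Re (dy s)))
      by exact (is_derive_Re_along_segment f z w _ s (Hf _ (Hin s Hs))).
    assert (HI : is_derive yi s (Im (dy s)))
      by exact (is_derive_Im_along_segment f z w _ s (Hf _ (Hin s Hs))).
    clearbody yr yi. unfold h.
    auto_derive; [repeat apply conj; try easy; eexists; eassumption|].
    rewrite (is_derive_unique (fun x : R => yr x) _ _ HR),
      (is_derive_unique (fun x : R => yi x) _ _ HI).
    unfold dh. ring. }
  destruct (MVT_gen h 0 1 dh) as [c [Hc E]].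
  - intros s Hs. rewrite Rmin_left, Rmax_right in Hs by lra. apply Hd. lra.
  - intros s Hs. rewrite Rmin_left, Rmax_right in Hs by lra.
    apply continuity_pt_filterlim. apply (ex_derive_continuous h).
    eexists. now apply Hd.
  - rewrite Rmin_left, Rmax_right in Hc by lra.
    (* The derivative of |y|^2 is twice the inner product of [y] and [dy], hence at most 2 |y| |dy|
       <= L |y|^2. *)
    assert (Hdh : (dh c <= 0)%R).
    { unfold dh. assert (He := exp_pos (- L * c)).
      assert (Hi : (yr c * Re (dy c) + yi c * Im (dy c)
                    <= Cmod (y c) * Cmod (dy c))%R) by apply Re_Im_inner_le.
      assert (Hm : (Cmod (dy c) <= K * Cmod (y c) * Cmod (w - z))%R).
      { unfold dy. rewrite !Cmod_mult. apply Rmult_le_compat_r; [apply Cmod_ge_0|].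
        apply Rmult_le_compat_r; [apply Cmod_ge_0|]. now apply Hk, Hin. }
      assert (Hs : (yr c * yr c + yi c * yi c = Cmod (y c) * Cmod (y c))%R).
      { pose proof (Cmod2_alt (y c)) as H2. unfold yr, yi. simpl in *. lra. }
      assert (Hp : (Cmod (y c) * Cmod (dy c)
                    <= Cmod (y c) * (K * Cmod (y c) * Cmod (w - z)))%R)
        by (apply Rmult_le_compat_l; [apply Cmod_ge_0|exact Hm]).
      rewrite Hs. unfold L at 1.
      apply Rmult_le_reg_r with (/ exp (- L * c))%R; [now apply Rinv_0_lt_compat|].
      rewrite Rmult_assoc, Rinv_r, Rmult_1_r, Rmult_0_l by lra. lra. }
    assert (H0 : h 0%R = 0%R).
    { unfold h, yr, yi, y.
      replace (z + 0%R * (w - z)) with z by ring. rewrite Hz. simpl. ring. }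
    assert (H1 : (yr 1 * yr 1 + yi 1 * yi 1 <= 0)%R).
    { assert (He := exp_pos (- L * 1)).
      assert (Hh : (h 1%R <= 0)%R) by lra. unfold h in Hh. nra. }
    assert (E1 : y 1%R = f w).
    { unfold y. f_equal. ring. }
    rewrite <- E1. apply injective_projections; simpl;
      [change (yr 1 = 0)%R|change (yi 1 = 0)%R]; nra.
Qed.

(** A locally constant property is constant along paths: its indicator [chi] along [gamma] is a real
    function with zero derivative on [0,1], so it agrees at both ends. *)
Lemma path_connected_iff (D P : C -> Prop) (a b : C) :
  path_connected D ->
  (forall z, D z -> exists r : R, (0 < r)%R /\
     forall w, (Cmod (w - z) < r)%R -> (P w <-> P z)) ->
  D a -> D b -> P a -> P b.
Proof.
  intros Hc Hloc Ha Hb HPa.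
  destruct (Hc a b Ha Hb) as [gamma [Hg [H0 H1]]].
  set (chi := fun s : R => if excluded_middle_informative (P (gamma s)) then 1%R else 0%R).
  assert (E : chi 0%R = chi 1%R).
  { apply (eq_is_derive chi 0 1); [|lra]. intros s Hs.
    destruct (Hg s Hs) as [Hcs HD]. destruct (Hloc _ HD) as [r [Hr Hw]].
    apply is_derive_ext_loc with (fun _ => chi s); [|apply is_derive_const].
    refine (filter_imp _ _ _ (continuous_C_Cmod gamma s r Hcs Hr)).
    intros u Hu. apply Hw in Hu. unfold chi.
    destruct (excluded_middle_informative (P (gamma s))),
      (excluded_middle_informative (P (gamma u))); tauto. }
  unfold chi in E. rewrite H0, H1 in E.
  destruct (excluded_middle_informative (P a)), (excluded_middle_informative (P b));
    try assumption; [lra|tauto].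
Qed.

(** A punctured disc is not convex, but any two of its points are joined by one or two segments that
    avoid the centre. *)
Lemma is_derive_0_punctured_ball (f : C -> C) (z : C) (r : R) :
  (forall w, w <> z -> (Cmod (w - z) < r)%R -> is_derive f w (RtoC 0)) ->
  forall v w, v <> z -> w <> z -> (Cmod (v - z) < r)%R -> (Cmod (w - z) < r)%R ->
  f v = f w.
Proof.
  intros Hf.
  assert (Hseg : forall v w, (Cmod (v - z) < r)%R -> (Cmod (w - z) < r)%R ->
    (forall s : R, (0 <= s <= 1)%R -> v + s * (w - v) <> z) -> f v = f w).
  { intros v w Hv Hw Hs. apply is_derive_0_segment. intros s Hs1. apply Hf; [auto|].
    replace (v + s * (w - v) - z) with (v - z + s * ((w - z) - (v - z))) by ring.
    now apply Cmod_convex. }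
  intros v w Hvz Hwz Hv Hw.
  assert (Hv0 : v - z <> 0) by now apply Cminus_eq_contra.
  destruct (classic (exists s : R, (0 <= s <= 1)%R /\ v + s * (w - v) = z))
    as [[s [Hs E]]|H].
  2: { apply Hseg; auto. intros s Hs E. apply H. now exists s. }
  (* [z] lies between [v] and [w]: go around it through [z + i (v - z)]. *)
  assert (Hs0 : s <> 0%R).
  { intros ->. apply Hvz. rewrite <- E. ring. }
  assert (Hs1 : s <> 1%R).
  { intros ->. apply Hwz. rewrite <- E. ring. }
  set (u := z + Ci * (v - z)).
  assert (Hu : (Cmod (u - z) < r)%R).
  { unfold u. replace (z + Ci * (v - z) - z) with (Ci * (v - z)) by ring.
    rewrite Cmod_mult, Cmod_Ci, Rmult_1_l. exact Hv. }
  (* Since [z] divides the segment at parameter [s], [w - z] is a negative real multiple of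
     [v - z]. *)
  assert (Ew : s * (w - z) = (s - 1)%R * (v - z)).
  { rewrite RtoC_minus. rewrite <- E. ring. }
  transitivity (f u).
  - apply Hseg; auto. intros x Hx Ex.
    assert (Ex' : (v - z) * ((1 - x)%R + x * Ci) = 0).
    { replace ((v - z) * ((1 - x)%R + x * Ci)) with (v + x * (u - v) - z)
        by (unfold u; rewrite RtoC_minus; ring).
      rewrite Ex. ring. }
    revert Ex'. apply Cmult_neq_0; [exact Hv0|]. intros Ex'.
    injection Ex'. intros. lra.
  - apply Hseg; auto. intros x Hx Ex.
    (* This is [s] times the displacement from [z] of the point [x] of the segment from [u] to [w].
       Its imaginary factor forces [x = 1], and then its real factor forces [s = 1]. *)
    assert (Ex' : (v - z) * ((x * (s - 1))%R + (s * (1 - x))%R * Ci) = 0).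
    { replace ((v - z) * ((x * (s - 1))%R + (s * (1 - x))%R * Ci))
        with (x * ((s - 1)%R * (v - z)) + s * (1 - x) * (u - z))
        by (unfold u; rewrite !RtoC_mult, !RtoC_minus; ring).
      rewrite <- Ew.
      replace (x * (s * (w - z)) + s * (1 - x) * (u - z))
        with (s * (u + x * (w - u) - z)) by ring.
      rewrite Ex. ring. }
    revert Ex'. apply Cmult_neq_0; [exact Hv0|]. intros Ex'.
    injection Ex'. intros E1 E2.
    assert (E3 : (s * (1 - x) = 0)%R) by lra.
    apply Rmult_integral in E3. destruct E3 as [E3|E3]; [easy|].
    apply Hs1. replace x with 1%R in E2 by lra. lra.
Qed.

(** At a zero with [l <> 0] one has |f w| >= |l| |w - z| / 2 nearby; at a nonzero value continuity
    suffices. Treating both cases together spares the caller from deciding which one occurs. *)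
Lemma isolated_zero (f : C -> C) (z l : C) :
  is_derive f z l -> (f z = 0 -> l <> 0) ->
  exists r : R, (0 < r)%R /\
    forall w, w <> z -> (Cmod (w - z) < r)%R -> f w <> 0.
Proof.
  intros Hf H0. rewrite is_derive_C_iff in Hf.
  destruct (classic (f z = 0)) as [Hz|Hz].
  - assert (Hl := proj1 (Cmod_gt_0 l) (H0 Hz)).
    destruct (Hf (Cmod l / 2)%R) as [r [Hr H]]; [lra|].
    exists r. split; [exact Hr|]. intros w Hwz Hw Hfw. specialize (H w Hw).
    assert (Hd : (0 < Cmod (w - z))%R)
      by now apply Cmod_gt_0, Cminus_eq_contra.
    rewrite Hfw, Hz in H.
    replace (0 - 0 - l * (w - z)) with (- (l * (w - z))) in H by ring.
    rewrite Cmod_opp, Cmod_mult in H. nra.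
  - assert (Hm := proj1 (Cmod_gt_0 (f z)) Hz).
    destruct (Hf 1%R Rlt_0_1) as [r [Hr H]].
    pose proof (Cmod_ge_0 l) as Hl.
    assert (Hq : (0 < Cmod (f z) / (Cmod l + 1))%R) by (apply Rdiv_lt_0_compat; lra).
    (* With the error constant 1, |f w - f z| <= (|l| + 1) |w - z|, which stays below |f z| on this
       radius. *)
    exists (Rmin r (Cmod (f z) / (Cmod l + 1))). split; [now apply Rmin_glb_lt|].
    intros w _ Hw Hfw.
    assert (Hw1 := Rlt_le_trans _ _ _ Hw (Rmin_l _ _)).
    assert (Hw2 := Rlt_le_trans _ _ _ Hw (Rmin_r _ _)).
    specialize (H w Hw1). rewrite Hfw in H.
    apply Rmult_lt_compat_r with (r := (Cmod l + 1)%R) in Hw2; [|lra].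
    replace (Cmod (f z) / (Cmod l + 1) * (Cmod l + 1))%R with (Cmod (f z)) in Hw2
      by (field; lra).
    assert (Ht : (Cmod (f z) <= Cmod (0 - f z - l * (w - z)) + Cmod (l * (w - z)))%R).
    { replace (Cmod (f z)) with (Cmod (0 - f z - l * (w - z) + l * (w - z))).
      - apply Cmod_triangle.
      - rewrite <- (Cmod_opp (f z)). f_equal. ring. }
    rewrite Cmod_mult in Ht. lra.
Qed.

Lemma is_derive_C_locally_bounded (f : C -> C) (z l : C) :
  is_derive f z l ->
  exists r K : R, (0 < r)%R /\ forall w, (Cmod (w - z) < r)%R -> (Cmod (f w) <= K)%R.
Proof.
  intros Hf. rewrite is_derive_C_iff in Hf.
  destruct (Hf 1%R Rlt_0_1) as [r [Hr H]].
  exists r, (Cmod (f z) + (Cmod l + 1) * r)%R. split; [exact Hr|].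
  intros w Hw. specialize (H w Hw).
  replace (f w) with ((f w - f z - l * (w - z)) + (f z + l * (w - z))) by ring.
  eapply Rle_trans; [apply Cmod_triangle|].
  pose proof (Cmod_triangle (f z) (l * (w - z))) as Ht. rewrite Cmod_mult in Ht.
  pose proof (Cmod_ge_0 l). nra.
Qed.

(** Vanishing of [f] is a locally constant property: a zero spreads over a disc on which [k] is
    bounded, by the Gronwall estimate, and a nonzero value persists by continuity. *)
Lemma linear_ode_zero (D : C -> Prop) (f k : C -> C) (a b : C) :
  open D -> path_connected D ->
  (forall z, D z -> is_derive f z (k z * f z)) -> analytic_on D k ->
  D a -> D b -> f a = 0 -> f b = 0.
Proof.
  intros Ho Hc Hf Hk. apply (path_connected_iff D (fun z => f z = 0)); [exact Hc|].
  intros z Hz. destruct (classic (f z = 0)) as [H0|H0].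
  - destruct (open_Cmod D z Ho Hz) as [r1 [Hr1 H1]].
    destruct (Hk z Hz) as [l Hl].
    destruct (is_derive_C_locally_bounded _ _ _ Hl) as [r2 [K [Hr2 H2]]].
    exists (Rmin r1 r2). split; [now apply Rmin_glb_lt|].
    intros w Hw. split; [easy|]. intros _.
    apply (linear_ode_zero_near f k z (Rmin r1 r2) K); try assumption.
    + intros v Hv. apply Hf, H1. exact (Rlt_le_trans _ _ _ Hv (Rmin_l _ _)).
    + intros v Hv. apply H2. exact (Rlt_le_trans _ _ _ Hv (Rmin_r _ _)).
  - destruct (isolated_zero f z _ (Hf z Hz)) as [r [Hr H]]; [easy|].
    exists r. split; [exact Hr|]. intros w Hw. split; [|easy].
    intros Hfw. destruct (classic (w = z)) as [->|Hwz]; [exact Hfw|].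
    now destruct (H w Hwz Hw).
Qed.

(** * Functions with zero derivative off isolated points *)

Lemma Cmod_diag (z : C) : Cmod (z - z) = 0%R.
Proof. rewrite <- Cmod_0. f_equal. ring. Qed.

Lemma exists_near_off (z w : C) (eps : R) : (0 < eps)%R ->
  exists v, v <> z /\ v <> w /\ (Cmod (v - w) < eps)%R.
Proof.
  intros He.
  assert (H : forall x : R, x <> 0%R -> w + x <> w).
  { intros x Hx E. apply (RtoC_neq_0 x Hx).
    replace (RtoC x) with (w + x - w) by ring. rewrite E. ring. }
  assert (Hm : forall x : R, Cmod (w + x - w) = Rabs x).
  { intros x. replace (w + x - w) with (RtoC x) by ring. apply Cmod_R. }
  destruct (classic (w + (eps / 2)%R = z)) as [E|E].
  - exists (w + (eps / 3)%R). split; [|split].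
    + rewrite <- E. intros E'. assert (E2 : RtoC (eps / 3) = RtoC (eps / 2)).
      { replace (RtoC (eps / 3)) with (w + (eps / 3)%R - w) by ring. rewrite E'. ring. }
      apply RtoC_inj in E2. lra.
    + apply H. lra.
    + rewrite Hm, Rabs_pos_eq; lra.
  - exists (w + (eps / 2)%R). split; [exact E|]. split; [apply H; lra|].
    rewrite Hm, Rabs_pos_eq; lra.
Qed.

(* Every point of [D], also an isolated point of the complement of [U], gets as
   value the constant that [f] takes on a punctured neighbourhood of it, and this
   value is locally constant. *)
Lemma is_derive_0_off_isolated (D U : C -> Prop) (f : C -> C) (a b : C) :
  path_connected D -> (forall z, U z -> D z) ->
  (forall z, D z -> exists r : R, (0 < r)%R /\
    forall w, w <> z -> (Cmod (w - z) < r)%R -> U w) ->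
  (forall z, U z -> is_derive f z (RtoC 0)) ->
  U a -> U b -> f a = f b.
Proof.
  intros Hc HUD HU Hf Ha Hb.
  assert (Hval : forall z, D z -> exists c r, (0 < r)%R /\
    forall w, U w -> (Cmod (w - z) < r)%R -> f w = c).
  { intros z Hz. destruct (HU z Hz) as [r [Hr H]].
    destruct (exists_near_off z z r Hr) as [v [_ [Hvz Hv]]].
    assert (Hp : forall w, w <> z -> (Cmod (w - z) < r)%R -> f w = f v).
    { intros w Hwz Hw. apply (is_derive_0_punctured_ball f z r); auto. }
    exists (f v), r. split; [exact Hr|]. intros w HUw Hw.
    destruct (classic (w = z)) as [->|Hwz]; [|now apply Hp].
    apply is_derive_0_segment. intros s Hs. apply Hf.
    (* The centre [z] itself may belong to [U]. The derivative is then zero there too, so the whole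
       segment from [z] to [v] can be used. *)
    destruct (classic (z + s * (v - z) = z)) as [->|Hne]; [exact HUw|].
    apply H; [exact Hne|].
    replace (z + s * (v - z) - z) with (s * (v - z)) by ring.
    eapply Rle_lt_trans; [now apply Cmod_segment|exact Hv]. }
  set (P := fun z => exists r, (0 < r)%R /\
    forall w, U w -> (Cmod (w - z) < r)%R -> f w = f a).
  assert (HPb : P b).
  { apply (path_connected_iff D P a b); auto.
    2: { destruct (Hval a (HUD a Ha)) as [c [r [Hr H]]].
         exists r. split; [exact Hr|]. intros w HUw Hw.
         rewrite (H w HUw Hw). symmetry. apply H; [exact Ha|].
         now rewrite Cmod_diag. }
    intros z Hz. destruct (Hval z Hz) as [c [r1 [Hr1 H1]]].
    destruct (HU z Hz) as [r2 [Hr2 H2]].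
    set (r := Rmin r1 r2).
    assert (Hr : (0 < r)%R) by now apply Rmin_glb_lt.
    assert (Hin : forall w v, (Cmod (v - w) < r - Cmod (w - z))%R -> (Cmod (v - z) < r)%R).
    { intros w v Hv. replace (v - z) with ((v - w) + (w - z)) by ring.
      eapply Rle_lt_trans; [apply Cmod_triangle|]. lra. }
    assert (Hcst : forall w, (Cmod (w - z) < r)%R -> (P w <-> c = f a)).
    { intros w Hw. split.
      - intros [r' [Hr' H']].
        (* [w] need not lie in [U]. A point [v] close to it and different from [z] does, and there
           the value required by [P w] meets the constant [c]. *)
        destruct (exists_near_off z w (Rmin r' (r - Cmod (w - z)))) as [v [Hvz [_ Hv]]].
        { apply Rmin_glb_lt; lra. }
        assert (Hvr := Hin w v (Rlt_le_trans _ _ _ Hv (Rmin_r _ _))).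
        assert (HUv : U v).
        { apply H2; [exact Hvz|]. exact (Rlt_le_trans _ _ _ Hvr (Rmin_r _ _)). }
        rewrite <- (H1 v HUv (Rlt_le_trans _ _ _ Hvr (Rmin_l _ _))).
        apply H'; [exact HUv|]. exact (Rlt_le_trans _ _ _ Hv (Rmin_l _ _)).
      - intros Hca. exists (r - Cmod (w - z))%R. split; [lra|].
        intros v HUv Hv. rewrite <- Hca. apply H1; [exact HUv|].
        exact (Rlt_le_trans _ _ _ (Hin w v Hv) (Rmin_l _ _)). }
    exists r. split; [exact Hr|]. intros w Hw.
    rewrite (Hcst w Hw), (Hcst z); [tauto|].
    now rewrite Cmod_diag. }
  destruct HPb as [r [Hr H]]. symmetry. apply H; [exact Hb|].
  now rewrite Cmod_diag.
Qed.

(** * The third Painleve system *)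

Lemma ex_derive_C (f : C -> C) (z : C) :
  ex_derive f z -> exists l : C, is_derive f z l.
Proof. intros [l Hl]. now exists l. Qed.

(** Differentiating g^n = f, which holds on a whole disc around [z], gives n g^(n-1) g' = f'; since
    f z is nonzero, so is g z, and this can be solved for g'. *)
Lemma is_derive_root_branch (n : nat) (D : C -> Prop) (f g : C -> C) (z l : C) :
  (exists r : R, (0 < r)%R /\ forall w, (Cmod (w - z) < r)%R -> D w) ->
  root_branch n D f g -> n <> 0%nat -> f z <> 0 ->
  is_derive f z l -> is_derive g z (g z * l / (RtoC (INR n) * f z)).
Proof.
  intros [r [Hr Hin]] [Hg Hp] Hn H0 Hf.
  assert (Hz : D z) by (apply Hin; now rewrite Cmod_diag).
  assert (Hn' : RtoC (INR n) <> 0) by now apply RtoC_neq_0, not_0_INR.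
  destruct (ex_derive_C _ _ (Hg z Hz)) as [m Hm].
  assert (E : RtoC (INR n) * g z ^ pred n * m = l).
  { rewrite <- (is_C_derive_unique f z l Hf). symmetry. apply is_C_derive_unique.
    apply (is_derive_local (fun w => g w ^ n) f z _ r Hr); [auto|].
    now apply is_derive_C_pow. }
  apply is_derive_eq with (1 := Hm). rewrite <- E, <- (Hp z Hz) in *.
  destruct n as [|n]; [easy|]. cbn [pred]. rewrite Cpow_S in *.
  assert (g z <> 0) by (intros Hc; apply H0; rewrite Hc; ring).
  assert (g z ^ n <> 0) by now apply Cpow_nz.
  field. auto.
Qed.

(** * Rational parametrization and the two algebraic identities *)

Lemma Ci_sqr : Ci * Ci = - (1).
Proof. unfold Ci. apply injective_projections; simpl; ring. Qed.

(** The hyperbola s^2 - r^2 = 1 factors as (s + r)(s - r) = 1, so s + r is a coordinate on it with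
    inverse s - r. *)
Lemma sum_diff_uniformization (s r : C) :
  s ^ 2 - r ^ 2 = 1 -> s + r <> 0 /\ s - r <> 0 /\
  s = ((s + r) + / (s + r)) / 2 /\ r = ((s + r) - / (s + r)) / 2.
Proof.
  intros H. assert (H1 : (s + r) * (s - r) = 1) by (rewrite <- H; ring).
  assert (H0 : s + r <> 0).
  { intros E. rewrite E, Cmult_0_l in H1. apply RtoC_inj in H1. lra. }
  assert (E : s - r = / (s + r)).
  { rewrite <- (Cmult_1_r (/ (s + r))), <- H1. field. exact H0. }
  split; [exact H0|]. split.
  { intros E'. rewrite E', Cmult_0_r in H1. apply RtoC_inj in H1. lra. }
  rewrite <- E. split; field; apply RtoC_neq_0; lra.
Qed.

(** Taking w = i x gives i x = w and i / x = - 1 / w, so the imaginary unit disappears from the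
    transformed formulas and [field] can decide the identities. *)
Lemma rational_parametrization (t p x s r : C) :
  x <> 0 -> x ^ 2 = t -> s ^ 2 = p -> r ^ 2 = p - 1 ->
  exists w u : C, w <> 0 /\ u <> 0 /\ x = - Ci * w /\ t = - w ^ 2 /\
    s = (u + / u) / 2 /\ r = (u - / u) / 2 /\ p = ((u + / u) / 2) ^ 2.
Proof.
  intros Hx <- <- Hr.
  destruct (sum_diff_uniformization s r) as [H0 [_ [Es Er]]]; [rewrite Hr; ring|].
  exists (Ci * x), (s + r).
  split; [now apply Cmult_neq_0; [apply Ci_nz|]|]. split; [exact H0|].
  split; [|split; [|split; [exact Es|split; [exact Er|now rewrite <- Es]]]].
  - transitivity (- (Ci * Ci) * x); [rewrite Ci_sqr|]; ring.
  - transitivity (- (Ci * Ci) * x ^ 2); [rewrite Ci_sqr|]; ring.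
Qed.

Lemma hamiltonian_sum (D : C -> Prop) (q p st sp sp1 : C -> C) (t : C) :
  generic D q p st sp sp1 t ->
  st t ^ 2 = t -> sp t ^ 2 = p t -> sp1 t ^ 2 = p t - 1 ->
  t / 4 * HW q st sp sp1 (t / 4) + t / 4 * HS q st sp sp1 (t / 4) +
  t / 4 * HE q st sp sp1 (t / 4) + t / 4 * HN q st sp sp1 (t / 4)
  = t * hamiltonian_along 0 0 q p t - 1 / 4.
Proof.
  intros [_ [Ht [_ [_ [Hst [_ [_ [H1 [H2 [H3 H4]]]]]]]]]] Et Ep Ep1.
  unfold HW, HS, HE, HN, hamiltonian_along, hamiltonian,
    QW, PW, QS, PS, QE, PE, QN, PN; cbv zeta.
  assert (C2 : RtoC 2 <> 0) by (apply RtoC_neq_0; lra).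
  assert (C4 : RtoC 4 <> 0) by (apply RtoC_neq_0; lra).
  replace (4 * (t / 4)) with t by (field; exact C4).
  destruct (rational_parametrization _ _ _ _ _ Hst Et Ep Ep1)
    as [w [u [Hw [Hu [Ex [Et' [Es [Er Ep']]]]]]]].
  clear Et Ep Ep1. revert Ht H1 H2 H3 H4 Et'.
  (* From here on the claim is an identity of rational functions in the independent quantities [a],
     [u], [w]. *)
  rewrite Ex, Es, Er, Ep'. generalize (q t) as a. intros a Ht H1 H2 H3 H4 ->.
  assert (Ew : Ci * (- Ci * w) = w)
    by (transitivity (- (Ci * Ci) * w); [|rewrite Ci_sqr]; ring).
  rewrite Ew in *.
  assert (Ew' : Ci / (- Ci * w) = - / w) by (field; split; [exact Hw|apply Ci_nz]).
  rewrite Ew' in *.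
  replace ((u + / u) / 2 - (u - / u) / 2) with (/ u) by (field; auto).
  replace ((u + / u) / 2 + (u - / u) / 2) with u by (field; auto).
  (* The side conditions of [field] are the four generic denominators cleared of 1/2 and of powers
     of 1/u, that is, multiplied by 4 u^2. *)
  assert (scale : forall X Y : C, X <> 0 -> Y = 4 * u ^ 2 * X -> Y <> 0).
  { intros X Y HX ->. apply Cmult_neq_0; [|exact HX].
    apply Cmult_neq_0; [exact C4|now apply Cpow_nz]. }
  field. cbv beta. repeat (split; [assumption|]).
  split; [|split; [|split]];
    [apply (scale _ _ H4)|apply (scale _ _ H3)|apply (scale _ _ H2)|apply (scale _ _ H1)];
    field; auto.
Qed.

(** With u = sqrt p + sqrt (p - 1), the W and E momenta add up to 2 sqrt p / u and the S and N
    momenta to 2 u sqrt p, while u + 1/u = 2 sqrt p. *)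
Lemma momentum_sum (D : C -> Prop) (q p st sp sp1 : C -> C) (t : C) :
  generic D q p st sp sp1 t ->
  st t ^ 2 = t -> sp t ^ 2 = p t -> sp1 t ^ 2 = p t - 1 ->
  PW q st sp sp1 (t / 4) + PS q st sp sp1 (t / 4) +
  PE q st sp sp1 (t / 4) + PN q st sp sp1 (t / 4) = 4 * p t.
Proof.
  intros [_ [Ht [_ [_ [Hst _]]]]] Et Ep Ep1.
  unfold PW, PS, PE, PN; cbv zeta.
  assert (C2 : RtoC 2 <> 0) by (apply RtoC_neq_0; lra).
  assert (C4 : RtoC 4 <> 0) by (apply RtoC_neq_0; lra).
  replace (4 * (t / 4)) with t by (field; exact C4).
  destruct (rational_parametrization _ _ _ _ _ Hst Et Ep Ep1)
    as [w [u [Hw [Hu [Ex [Et' [Es [Er Ep']]]]]]]].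
  rewrite Ex, Es, Er, Ep'. generalize (q t) as a. intros a.
  assert (Ew : Ci * (- Ci * w) = w)
    by (transitivity (- (Ci * Ci) * w); [|rewrite Ci_sqr]; ring).
  rewrite Ew.
  assert (Ew' : Ci / (- Ci * w) = - / w) by (field; split; [exact Hw|apply Ci_nz]).
  rewrite Ew'.
  replace ((u + / u) / 2 - (u - / u) / 2) with (/ u) by (field; auto).
  replace ((u + / u) / 2 + (u - / u) / 2) with u by (field; auto).
  field. auto.
Qed.

(** Constant subexpressions are recognized first and not taken apart. Nonvanishing of denominators
    and unknown derivatives of atomic functions remain as goals. *)
Ltac derive_C :=
  lazymatch goal with
  | |- is_derive (fun _ => ?c) _ _ => apply is_derive_C_const
  | |- is_derive (fun x => x) _ _ => apply is_derive_C_id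
  | |- is_derive (fun x => (@?f x + @?g x)%C) _ _ => apply (is_derive_C_plus f g); derive_C
  | |- is_derive (fun x => (@?f x - @?g x)%C) _ _ => apply (is_derive_C_minus f g); derive_C
  | |- is_derive (fun x => (- @?f x)%C) _ _ => apply (is_derive_C_opp f); derive_C
  | |- is_derive (fun x => (@?f x * @?g x)%C) _ _ => apply (is_derive_C_mult f g); derive_C
  | |- is_derive (fun x => (@?f x ^ ?n)%C) _ _ => apply (is_derive_C_pow f n); derive_C
  | |- is_derive (fun x => (@?f x / @?g x)%C) _ _ =>
      apply (is_derive_C_div f g); [|derive_C|derive_C]
  | |- _ => try eassumption
  end.

(** * Derivatives along the solution and zeros of the denominators *)

Lemma hamiltonian_derive_p (v1 v2 q p t : C) : t <> 0 ->
  C_derive (fun y => hamiltonian v1 v2 q y t) p = (2 * q ^ 2 * p - q ^ 2 - v1 * q + t) / t.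
Proof.
  intros Ht. apply is_C_derive_unique. unfold hamiltonian.
  eapply is_derive_eq; [derive_C; exact Ht|].
  rewrite INR_IZR_INZ. cbn [Z.of_nat Pos.of_succ_nat Pos.succ pred]. field. exact Ht.
Qed.

Lemma hamiltonian_derive_q (v1 v2 q p t : C) : t <> 0 ->
  C_derive (fun x => hamiltonian v1 v2 x p t) q
  = (2 * q * p ^ 2 - (2 * q + v1) * p + (v1 + v2) / 2) / t.
Proof.
  intros Ht. apply is_C_derive_unique. unfold hamiltonian.
  eapply is_derive_eq; [derive_C; exact Ht|].
  rewrite INR_IZR_INZ. cbn [Z.of_nat Pos.of_succ_nat Pos.succ pred]. field. exact Ht.
Qed.

(** The system gives q s r the derivative s r. As s r = - (i / x)(i x s r), this term combines with
    the derivative of i x r or i x s into a multiple of the denominator, up to a remainder free of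
    q. *)
Lemma denominators_derive (q s r x : C -> C) (z : C) :
  x z <> 0 -> x z ^ 2 = z -> r z ^ 2 = s z ^ 2 - 1 ->
  is_derive q z ((2 * q z ^ 2 * s z ^ 2 - q z ^ 2 + z) / z) ->
  is_derive s z (- (q z * s z * r z ^ 2) / z) ->
  is_derive r z (- (q z * r z * s z ^ 2) / z) ->
  is_derive x z (x z / (2 * z)) ->
  let d1 := fun t => 1 / 2 - q t * s t * r t + Ci * x t * r t in
  let d2 := fun t => 1 / 2 + q t * s t * r t - Ci * x t * r t in
  let d3 := fun t => 1 / 2 + q t * s t * r t + Ci * x t * s t in
  let d4 := fun t => 1 / 2 - q t * s t * r t - Ci * x t * s t in
  is_derive d1 z (Ci / x z * (- (s z - r z) / 2 + s z * d1 z)) /\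
  is_derive d2 z (Ci / x z * (- (s z + r z) / 2 + s z * d2 z)) /\
  is_derive d3 z (Ci / x z * ((s z + r z) / 2 + - r z * d3 z)) /\
  is_derive d4 z (Ci / x z * (- (s z - r z) / 2 + - r z * d4 z)).
Proof.
  intros Hx Ex Er Hq Hs Hr Hx' d1 d2 d3 d4.
  assert (C2 : RtoC 2 <> 0) by (apply RtoC_neq_0; lra).
  assert (Ci2 := Ci_sqr).
  assert (Er' : r z * r z = s z * s z - 1).
  { transitivity (r z ^ 2); [ring|]. rewrite Er. ring. }
  unfold d1, d2, d3, d4.
  split; [|split; [|split]]; (eapply is_derive_eq; [derive_C|]);
    revert Hx Ex Er';
    generalize (q z) as Q, (s z) as S, (r z) as R, (x z) as X; intros;
    (* The identities hold modulo i^2 = -1 and r^2 = s^2 - 1, once [z] is replaced by the square of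
       [X]. *)
    subst z; field [Ci2 Er']; auto.
Qed.

Lemma PIII'_solution_0_derive (D : C -> Prop) (q p : C -> C) (t : C) :
  PIII'_solution 0 0 D q p -> D t -> t <> 0 ->
  is_derive q t ((2 * q t ^ 2 * p t - q t ^ 2 + t) / t) /\
  is_derive p t (- (2 * q t * p t * (p t - 1)) / t).
Proof.
  intros Hsol HDt Ht. destruct (Hsol t HDt) as [Hq Hp]. split.
  - apply is_derive_eq with (1 := Hq). rewrite hamiltonian_derive_p by exact Ht.
    field. exact Ht.
  - apply is_derive_eq with (1 := Hp). rewrite hamiltonian_derive_q by exact Ht.
    field. exact Ht.
Qed.

Lemma PIII'_solution_0_p_neq (D : C -> Prop) (q p : C -> C) (a b : C) :
  open D -> path_connected D -> (forall t, D t -> t <> 0) ->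
  PIII'_solution 0 0 D q p -> D a -> D b ->
  (p a <> 0 -> p b <> 0) /\ (p a - 1 <> 0 -> p b - 1 <> 0).
Proof.
  intros Ho Hc H0 Hsol Ha Hb.
  assert (Hd : forall t, D t -> is_derive q t ((2 * q t ^ 2 * p t - q t ^ 2 + t) / t) /\
      is_derive p t (- (2 * q t * p t * (p t - 1)) / t)).
  { intros t Ht. apply (PIII'_solution_0_derive D); auto. }
  split; intros Hpa Hpb; apply Hpa.
  (* A zero at [b] would propagate back to [a]. *)
  - apply (linear_ode_zero D p (fun t => - (2 * q t * (p t - 1)) / t) b a); auto.
    + intros t Ht. destruct (Hd t Ht) as [_ Hp].
      apply is_derive_eq with (1 := Hp). field. auto.
    + intros t Ht. destruct (Hd t Ht) as [Hq Hp]. eexists. derive_C. auto.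
  - apply (linear_ode_zero D (fun t => p t - 1) (fun t => - (2 * q t * p t) / t) b a); auto.
    + intros t Ht. destruct (Hd t Ht) as [_ Hp].
      eapply is_derive_eq; [derive_C|]. field. auto.
    + intros t Ht. destruct (Hd t Ht) as [Hq Hp]. eexists. derive_C. auto.
Qed.

(** The generic point [a] makes [p] and [p - 1] nonvanishing on all of [D]. Only the four
    denominators can then vanish in [D], each at isolated points. *)
Lemma generic_punctured_neighbourhood (D : C -> Prop) (q p st sp sp1 : C -> C) (a z : C) :
  open D -> path_connected D -> (forall t, D t -> t <> 0) ->
  PIII'_solution 0 0 D q p ->
  root_branch 2 D (fun t => t) st -> root_branch 2 D p sp ->
  root_branch 2 D (fun t => p t - 1) sp1 ->
  generic D q p st sp sp1 a -> D z ->
  exists r : R, (0 < r)%R /\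
    forall w, w <> z -> (Cmod (w - z) < r)%R -> generic D q p st sp sp1 w.
Proof.
  intros Ho Hc H0 Hsol Hst Hsp Hsp1 Ha Hz.
  destruct Ha as [HDa [_ [Hpa [Hp1a _]]]].
  assert (C2 : RtoC 2 <> 0) by (apply RtoC_neq_0; lra).
  assert (Hp0 : forall w, D w -> p w <> 0).
  { intros w Hw. now apply (PIII'_solution_0_p_neq D q p a w). }
  assert (Hp1 : forall w, D w -> p w - 1 <> 0).
  { intros w Hw. now apply (PIII'_solution_0_p_neq D q p a w). }
  assert (Hst0 : forall w, D w -> st w <> 0).
  { intros w Hw E. apply (H0 w Hw). rewrite <- (proj2 Hst w Hw), E. ring. }
  assert (Hsum : forall w, D w -> sp w + sp1 w <> 0 /\ sp w - sp1 w <> 0).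
  { intros w Hw. destruct (sum_diff_uniformization (sp w) (sp1 w)) as [H1 [H2 _]].
    - rewrite (proj2 Hsp w Hw), (proj2 Hsp1 w Hw). ring.
    - now split. }
  destruct (PIII'_solution_0_derive D q p z Hsol Hz (H0 z Hz)) as [Hq Hp].
  assert (Es := proj2 Hsp z Hz). assert (Er := proj2 Hsp1 z Hz). cbn beta in Er.
  assert (Hball := open_Cmod D z Ho Hz).
  assert (Hs : is_derive sp z (- (q z * sp z * sp1 z ^ 2) / z)).
  { eapply is_derive_eq; [eapply (is_derive_root_branch 2 D p sp z _ Hball Hsp); eauto|].
    rewrite Er, INR_IZR_INZ. cbn [Z.of_nat Pos.of_succ_nat Pos.succ]. field. auto. }
  assert (Hr : is_derive sp1 z (- (q z * sp1 z * sp z ^ 2) / z)).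
  { eapply is_derive_eq.
    - eapply (is_derive_root_branch 2 D (fun t => p t - 1) sp1 z _ Hball Hsp1); auto.
      derive_C.
    - rewrite Es, INR_IZR_INZ. cbn [Z.of_nat Pos.of_succ_nat Pos.succ]. field. auto. }
  assert (Hx : is_derive st z (st z / (2 * z))).
  { eapply is_derive_eq.
    - eapply (is_derive_root_branch 2 D (fun t => t) st z _ Hball Hst); auto. derive_C.
    - rewrite INR_IZR_INZ. cbn [Z.of_nat Pos.of_succ_nat Pos.succ]. field. auto. }
  destruct (denominators_derive q sp sp1 st z) as [H1 [H2 [H3 H4]]]; auto.
  { exact (proj2 Hst z Hz). }
  { now rewrite Er, Es. }
  { now rewrite Es. }
  (* At a zero of [d] the derivative reduces to i / sqrt t times [v], and [v] is half of the
     nonvanishing [u] up to sign. *)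
  assert (Hd : forall d c u v : C, u <> 0 -> v = u / 2 \/ v = - u / 2 -> d = 0 ->
     Ci / st z * (v + c * d) <> 0).
  { intros d c u v Hu Hv -> E. apply Hu.
    assert (E' : v = 0).
    { transitivity (st z / Ci * (Ci / st z * (v + c * 0))).
      - field. split; [now apply Hst0|apply Ci_nz].
      - rewrite E. ring. }
    destruct Hv as [-> | ->].
    - transitivity (2 * (u / 2)); [field; exact C2|]. rewrite E'. ring.
    - transitivity (- 2 * (- u / 2)); [field; exact C2|]. rewrite E'. ring. }
  destruct (Hsum z Hz) as [Hplus Hminus].
  destruct (isolated_zero _ _ _ H1) as [r1 [Hr1 N1]].
  { apply (Hd _ _ _ _ Hminus). now right. }
  destruct (isolated_zero _ _ _ H2) as [r2 [Hr2 N2]].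
  { apply (Hd _ _ _ _ Hplus). now right. }
  destruct (isolated_zero _ _ _ H3) as [r3 [Hr3 N3]].
  { apply (Hd _ _ _ _ Hplus). now left. }
  destruct (isolated_zero _ _ _ H4) as [r4 [Hr4 N4]].
  { apply (Hd _ _ _ _ Hminus). now right. }
  destruct Hball as [r5 [Hr5 N5]].
  exists (Rmin (Rmin r1 r2) (Rmin (Rmin r3 r4) r5)). split.
  { repeat apply Rmin_glb_lt; assumption. }
  intros w Hwz Hw.
  apply Rmin_Rgt_l in Hw as [Hw12 Hw]. apply Rmin_Rgt_l in Hw12 as [Hw1 Hw2].
  apply Rmin_Rgt_l in Hw as [Hw34 Hw5]. apply Rmin_Rgt_l in Hw34 as [Hw3 Hw4].
  assert (HDw : D w) by now apply N5.
  destruct (Hsum w HDw).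
  unfold generic. repeat (split; [now auto|]). now apply N4.
Qed.

(** * The product of the tau-functions *)

Lemma tau_product_constant (D : C -> Prop) (q p st sp sp1 root4 : C -> C)
  (tau tauW tauS tauE tauN : C -> C) (a b : C) :
  open D -> path_connected D -> (forall t, D t -> t <> 0) ->
  PIII'_solution 0 0 D q p ->
  root_branch 2 D (fun t => t) st -> root_branch 2 D p sp ->
  root_branch 2 D (fun t => p t - 1) sp1 ->
  root_branch 4 (fun T => D (4 * T)) (fun T => T) root4 ->
  tau_function (generic D q p st sp sp1) (hamiltonian_along 0 0 q p) tau ->
  tau_function (fun T => generic D q p st sp sp1 (4 * T)) (HW q st sp sp1) tauW ->
  tau_function (fun T => generic D q p st sp sp1 (4 * T)) (HS q st sp sp1) tauS ->
  tau_function (fun T => generic D q p st sp sp1 (4 * T)) (HE q st sp sp1) tauE ->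
  tau_function (fun T => generic D q p st sp sp1 (4 * T)) (HN q st sp sp1) tauN ->
  let F := fun t => root4 (t / 4) * tauW (t / 4) * tauS (t / 4) * tauE (t / 4)
                    * tauN (t / 4) / tau t in
  generic D q p st sp sp1 a -> generic D q p st sp sp1 b -> F a = F b.
Proof.
  intros Ho Hc H0 Hsol Hst Hsp Hsp1 Hroot Htau HtW HtS HtE HtN F Ha Hb.
  assert (C4 : RtoC 4 <> 0) by (apply RtoC_neq_0; lra).
  assert (Hscale : forall f t l, is_derive f (t / 4) l ->
    is_derive (fun s => f (s / 4)) t (l / 4)).
  { intros f t l Hf. apply (is_derive_C_comp f (fun s => s / 4) t l (/ 4) Hf).
    eapply is_derive_eq; [derive_C; exact C4|]. field. }
  assert (Hlog : forall (U : C -> Prop) H f t, tau_function U H f -> U t ->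
    is_derive f t (H t * f t)).
  { intros U H f t Hf Ht. destruct (Hf t Ht) as [Hnz [Hex ->]].
    apply is_derive_eq with (1 := C_derive_correct f t 0 Hex). field. exact Hnz. }
  apply (is_derive_0_off_isolated D (generic D q p st sp sp1)); auto.
  { intros z Hz. apply Hz. }
  { intros z Hz. apply (generic_punctured_neighbourhood D q p st sp sp1 a z); auto. }
  clear a b Ha Hb. intros t Ht.
  assert (HDt : D t) by apply Ht. assert (Ht0 := H0 t HDt).
  assert (E4 : 4 * (t / 4) = t) by (field; exact C4).
  assert (Ht' : generic D q p st sp sp1 (4 * (t / 4))) by now rewrite E4.
  pose proof (Hscale _ _ _ (Hlog _ _ _ _ HtW Ht')) as DW.
  pose proof (Hscale _ _ _ (Hlog _ _ _ _ HtS Ht')) as DS.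
  pose proof (Hscale _ _ _ (Hlog _ _ _ _ HtE Ht')) as DE.
  pose proof (Hscale _ _ _ (Hlog _ _ _ _ HtN Ht')) as DN.
  pose proof (Hlog _ _ _ _ Htau Ht) as Dt.
  (* So T^(1/4) has logarithmic derivative 1 / (4 t) in t, which compensates the term - 1/4 of the
     Hamiltonian identity. *)
  assert (DR : is_derive (fun s => root4 (s / 4)) t (root4 (t / 4) / t / 4)).
  { apply Hscale. eapply is_derive_eq.
    - apply (is_derive_root_branch 4 (fun T => D (4 * T)) (fun T => T) root4 (t / 4) 1);
        auto.
      + destruct (open_Cmod D t Ho HDt) as [r [Hr Hin]].
        exists (r / 4)%R. split; [lra|]. intros w Hw. apply Hin.
        replace (4 * w - t) with (4 * (w - t / 4)) by (field; exact C4).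
        rewrite Cmod_mult, Cmod_R, Rabs_pos_eq by lra. lra.
      + intros E. apply Ht0. rewrite <- E4, E. ring.
      + apply is_derive_C_id.
    - rewrite INR_IZR_INZ. cbn [Z.of_nat Pos.of_succ_nat Pos.succ]. field. auto. }
  assert (Hsum := hamiltonian_sum D q p st sp sp1 t Ht
    (proj2 Hst t HDt) (proj2 Hsp t HDt) (proj2 Hsp1 t HDt)).
  assert (Htn : tau t <> 0) by apply (Htau t Ht).
  eapply is_derive_eq; [unfold F; derive_C; exact Htn|].
  (* The Hamiltonian identity solved for [HN]; inserting it makes the derivative of the quotient
     vanish. *)
  assert (EN : HN q st sp sp1 (t / 4) = 4 * hamiltonian_along 0 0 q p t - 1 / t
    - HW q st sp sp1 (t / 4) - HS q st sp sp1 (t / 4) - HE q st sp sp1 (t / 4)).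
  { transitivity (4 / t * (t / 4 * HN q st sp sp1 (t / 4))); [field; auto|].
    replace (t / 4 * HN q st sp sp1 (t / 4)) with
      (t * hamiltonian_along 0 0 q p t - 1 / 4 - (t / 4 * HW q st sp sp1 (t / 4)
       + t / 4 * HS q st sp sp1 (t / 4) + t / 4 * HE q st sp sp1 (t / 4)))
      by (rewrite <- Hsum; ring).
    field. auto. }
  rewrite EN. field. auto.
Qed.

Theorem proposition3
  (D : C -> Prop) (hD : simply_connected_domain D)
  (hD0 : forall t : C, D t -> t <> 0)
  (q p : C -> C) (hsol : PIII'_solution 0 0 D q p)
  (st sp sp1 root4 : C -> C)
  (hst : root_branch 2 D (fun t : C => t) st)
  (hsp : root_branch 2 D p sp)
  (hsp1 : root_branch 2 D (fun t : C => p t - 1) sp1)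
  (hroot4 : root_branch 4 (fun T : C => D (4 * T)) (fun T : C => T) root4) :
  (forall t T : C, T = t / 4 -> generic D q p st sp sp1 t ->
     T * HW q st sp sp1 T + T * HS q st sp sp1 T +
     T * HE q st sp sp1 T + T * HN q st sp sp1 T
     = t * hamiltonian_along 0 0 q p t - 1 / 4) /\
  (forall t T : C, T = t / 4 -> generic D q p st sp sp1 t ->
     PW q st sp sp1 T + PS q st sp sp1 T + PE q st sp sp1 T + PN q st sp sp1 T
     = 4 * p t) /\
  (forall tau tauW tauS tauE tauN : C -> C,
     tau_function (generic D q p st sp sp1) (hamiltonian_along 0 0 q p) tau ->
     tau_function (fun T : C => generic D q p st sp sp1 (4 * T))
       (HW q st sp sp1) tauW ->
     tau_function (fun T : C => generic D q p st sp sp1 (4 * T))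
       (HS q st sp sp1) tauS ->
     tau_function (fun T : C => generic D q p st sp sp1 (4 * T))
       (HE q st sp sp1) tauE ->
     tau_function (fun T : C => generic D q p st sp sp1 (4 * T))
       (HN q st sp sp1) tauN ->
     exists c : C, c <> 0 /\
       forall t T : C, T = t / 4 -> generic D q p st sp sp1 t ->
         root4 T * tauW T * tauS T * tauE T * tauN T = c * tau t).
Proof.
  assert (Ho : open D) by apply hD.
  assert (Hc : path_connected D) by apply hD.
  split; [|split].
  - intros t T -> Ht. assert (HDt : D t) by apply Ht.
    apply (hamiltonian_sum D); [exact Ht|now apply hst|now apply hsp|now apply hsp1].
  - intros t T -> Ht. assert (HDt : D t) by apply Ht.
    apply (momentum_sum D); [exact Ht|now apply hst|now apply hsp|now apply hsp1].
  - intros tau tauW tauS tauE tauN Htau HtW HtS HtE HtN.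
    set (F := fun t => root4 (t / 4) * tauW (t / 4) * tauS (t / 4) * tauE (t / 4)
                       * tauN (t / 4) / tau t).
    (* The constant is the value of the quotient [F] at some generic point; if there is none, the
       claim is vacuous and 1 serves. *)
    destruct (classic (exists a, generic D q p st sp sp1 a)) as [[a Ha]|Hnone].
    2: { exists 1. split; [apply RtoC_neq_0; lra|].
         intros t T _ Ht. destruct Hnone. now exists t. }
    exists (F a). split.
    + assert (E4 : 4 * (a / 4) = a) by (field; apply RtoC_neq_0; lra).
      assert (Ha' : generic D q p st sp sp1 (4 * (a / 4))) by now rewrite E4.
      (* Its fourth power is a / 4, and 0 is not in [D]. *)
      assert (Hr : root4 (a / 4) <> 0).
      { intros E. apply (hD0 a); [apply Ha|].
        rewrite <- E4, <- (proj2 hroot4 (a / 4)), E; [ring|apply Ha']. }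
      unfold F, Cdiv at 1.
      repeat apply Cmult_neq_0;
        [exact Hr|apply (HtW _ Ha')|apply (HtS _ Ha')|apply (HtE _ Ha')
        |apply (HtN _ Ha')|].
      intros E. apply C1_nz. rewrite <- (Cinv_r (tau a)), E; [ring|apply (Htau a Ha)].
    + intros t T -> Ht.
      replace (F a) with (F t).
      * unfold F. field. apply (Htau t Ht).
      * apply (tau_product_constant D q p st sp sp1 root4); auto.
Qed.
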